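(* Consider the Polish Algorithm for the law $abc{*}{*} = ab{*}aac{*}{*}{*}$ (that is, $a(bc)=(ab)(a(ac))$). It converges (terminates) for every pair of terms $u,v\in\mathbf{T}$ with $\mathrm{depth}(u)\le 5$ and $\mathrm{depth}(v)\le 5$. It diverges (never terminates) for some pairs of terms of depth $\le 6$; for example, it diverges for the pair $$1110100,\qquad 11010111000,$$ where $1$ denotes the variable $x$ and $0$ denotes the operation symbol $*$.
   Context: Terms. $\mathbf{T}$ is the set of terms in one variable $x$ and one binary operation symbol $*$ in right Polish notation: it is the smallest set of finite words over the alphabet $\{x,*\}$ with $x \in \mathbf{T}$ and $st* \in \mathbf{T}$ whenever $s,t\in\mathbf{T}$ (the word $st*$ represents the product $s\cdot t$). One writes $1$ for $x$ and $0$ for $*$, e.g. $xx{*}x{*}=11010$. The depth of a term is its number of occurrences of $x$. A term $v$ is viewed as a word $v(0)v(1)\cdots v(n-1)$ with $n=\mathrm{length}(v)$. First difference. For $u,v\in\mathbf{T}$, $d(u,v)$ is the least $i<\min(\mathrm{length}(u),\mathrm{length}(v))$ with $u(i)\ne v(i)$ if such an $i$ exists, and $d(u,v)=\infty$ otherwise. Dynamic range. Let $d=d(u,v)<\infty$ and $v(d)=*$ (so $u(d)=x$). Then $u$ and $v$ can be written uniquely as $$u = A\,u_0\,u_1\,u_2 * u_3 * \cdots u_n * *\, B,\qquad v = A\,u_0\,u_1 *\, C,$$ where $n\ge 2$, $u_0,\dots,u_n\in\mathbf{T}$, $A,B,C$ are strings, and the first letter of $u_2$ is at position $d$ in $u$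 (so the displayed subterm of $u$ is $u_0\cdot((\cdots((u_1\cdot u_2)\cdot u_3)\cdots)\cdot u_n)$). Polish Algorithm for $abc{*}{*} = ab{*}aac{*}{*}{*}$. Given $(u,v)$, stop if $d(u,v)=\infty$. Otherwise let $d=d(u,v)$. If $v(d)=*$, put $v'=v$ and, with the notation above, $$u' = A\,u_0\,u_1 *\, u_0\,u_0\,u_2 *{*}*\, u_0\,u_0\,u_3 *{*}* \cdots u_0\,u_0\,u_n *{*}*\, B .$$ If $u(d)=*$, put $u'=u$ and define $v'$ analogously with the roles of $u$ and $v$ exchanged. Passing from $(u,v)$ to $(u',v')$ is one step. The algorithm repeats steps; it terminates (converges) on $(u,v)$ if after finitely many steps it reaches a pair $(u^*,v^* )$ with $d(u^*,v^* )=\infty$, and diverges otherwise. *)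

(* Defs.v *)
From mathcomp Require Import all_boot.

Set Implicit Arguments.
Unset Strict Implicit.
Unset Printing Implicit Defensive.

Definition letter := bool.
Definition word := seq letter.

Declare Scope letter_scope.
Delimit Scope letter_scope with letter.
Notation "1" := (true : letter) : letter_scope.
Notation "0" := (false : letter) : letter_scope.

Definition var : letter := 1%letter.
Definition star : letter := 0%letter.

(* Right Polish notation: the product of s and t is the word s t *. *)
Inductive is_term : word -> Prop :=
| is_term_var : is_term [:: var]
| is_term_op (s t : word) :
    is_term s -> is_term t -> is_term (s ++ t ++ [:: star]).

Definition depth (u : word) : nat := count_mem var u.

(* [zip] truncates to the shorter word, so [None] (that is, d(u,v) = oo) also
   covers the case where one word is a prefix of the other. *)
Definition first_diff (u v : word) : option nat :=
  let i := find (fun p : letter * letter => p.1 != p.2) (zip u v) in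
  if i < minn (size u) (size v) then Some i else None.

(* [us] lists u_2, ..., u_n (n >= 2), so that
     u  = A u_0 u_1 u_2 * u_3 * ... u_n * * B,
     v  = A u_0 u_1 * C,
     u' = A u_0 u_1 * u_0 u_0 u_2 *** u_0 u_0 u_3 *** ... u_0 u_0 u_n *** B,
   with the first letter of u_2 at position d in u. *)
Definition expands (d : nat) (u v u' : word) : Prop :=
  exists (A B C u0 u1 : word) (us : seq word),
    [/\ is_term u0, is_term u1, (forall w, w \in us -> is_term w)
      & 1 <= size us] /\
    [/\ size (A ++ u0 ++ u1) = d,
        u = A ++ u0 ++ u1 ++ flatten [seq w ++ [:: star] | w <- us]
              ++ [:: star] ++ B,
        v = A ++ u0 ++ u1 ++ [:: star] ++ C
      & u' = A ++ u0 ++ u1 ++ [:: star]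
               ++ flatten [seq u0 ++ u0 ++ w ++ [:: star; star; star] | w <- us]
               ++ B].

Inductive polish_step (u v : word) : word -> word -> Prop :=
| polish_step_left (d : nat) (u' : word) :
    first_diff u v = Some d -> nth var v d = star ->
    expands d u v u' -> polish_step u v u' v
| polish_step_right (d : nat) (v' : word) :
    first_diff u v = Some d -> nth var u d = star ->
    expands d v u v' -> polish_step u v u v'.

Inductive converges (u v : word) : Prop :=
| converges_stop : first_diff u v = None -> converges u v
| converges_step (u' v' : word) :
    polish_step u v u' v' -> converges u' v' -> converges u v.

Definition diverges (u v : word) : Prop := ~ converges u v.

(* Main.v *)
Require Import Defs.
From mathcomp Require Import all_boot.

(** A step of the algorithm is computed by a stack parser: scanning a word from
    the left and reducing at each star leaves the maximal complete subterms on
    the stack, so the words u_0, u_1, ..., u_n of the dynamic range, hence the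
    step, are determined by u and d.  Convergence in depth at most 5 is then a
    finite computation.

    A step only touches the dynamic range, so it commutes with adding a common
    prefix and arbitrary suffixes to the two words.  Hence a pair (a, b) which
    is carried by some number of steps to a pair (Q a R, Q b S) runs forever, in
    every context.  The pair of the theorem contains such a self-reproducing
    pair, of period 5, after 19 steps. *)

(** * Stack parsing and the dynamic range *)

Definition push (stack : seq word) (l : letter) : seq word :=
  if l then [:: var] :: stack
  else if stack is t :: s :: stack' then (s ++ t ++ [:: star]) :: stack'
  else [::].

Lemma foldl_push_term {t : word} (stack : seq word) :
  is_term t -> foldl push stack t = t :: stack.
Proof.
move=> tt; elim: tt stack => {t} [|s t _ IHs _ IHt] stack //.
by rewrite !foldl_cat IHs IHt.
Qed.

(** A star that meets fewer than two subterms empties the stack. Everything read up to that star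
    then goes into A. *)
Lemma foldl_push_sound (w : word) :
  exists2 A, w = A ++ flatten (rev (foldl push [::] w))
    & forall t, t \in foldl push [::] w -> is_term t.
Proof.
elim/last_ind: w => [|w l [A wE tP]]; first by exists [::].
rewrite -cats1 foldl_cat /=.
set stk := foldl _ _ w in wE tP *; case: l => /=.
  exists A; first by rewrite rev_cons flatten_rcons catA -wE.
  by move=> t; rewrite inE => /orP[/eqP->|/tP//]; exact: is_term_var.
case: stk wE tP => [|t [|s stk]] wE tP.
- by exists (w ++ [:: false]); rewrite ?cats0.
- by exists (w ++ [:: false]); rewrite ?cats0.
exists A.
  by rewrite {1}wE !rev_cons !flatten_rcons -!catA.
move=> r; rewrite inE => /orP[/eqP->|rs].
  by apply: is_term_op; apply: tP; rewrite !inE eqxx ?orbT.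
by apply: tP; rewrite !inE rs !orbT.
Qed.

(* Reads u_2 * u_3 * ... u_n * * B and returns ([u_2, ..., u_n], B); the stack
   holds the subterms of the factor being read. *)
Fixpoint arguments (stack : seq word) (w : word) : option (seq word * word) :=
  if w is l :: w' then
    match l, stack with
    | false, [::] => Some ([::], w')
    | false, [:: t] =>
        omap (fun p : seq word * word => (t :: p.1, p.2)) (arguments [::] w')
    | false, t :: s :: stack' =>
        arguments ((s ++ t ++ [:: star]) :: stack') w'
    | true, _ => arguments ([:: var] :: stack) w'
    end
  else None.

Lemma arguments_cat_term {t : word} (stack : seq word) (w : word) :
  is_term t -> arguments stack (t ++ w) = arguments (t :: stack) w.
Proof.
move=> tt; elim: tt stack w => {t} [|s t _ IHs _ IHt] stack w //.
by rewrite -!catA IHs IHt.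
Qed.

(** A factor is a term, so reading it leaves it alone on the stack. A star over a single entry thus
    marks the end of a factor, and a star over the empty stack the end of the list. *)
Lemma arguments_complete (us : seq word) (B : word) :
  (forall w, w \in us -> is_term w) ->
  arguments [::] (flatten [seq w ++ [:: star] | w <- us] ++ [:: star] ++ B)
  = Some (us, B).
Proof.
elim: us => [|w us IH] usP //=.
rewrite -!catA arguments_cat_term; last by apply: usP; rewrite mem_head.
by rewrite /= IH // => x xus; apply: usP; rewrite inE xus orbT.
Qed.

Lemma arguments_sound {stack : seq word} {w : word} {us : seq word} {B : word} :
  (forall t, t \in stack -> is_term t) -> arguments stack w = Some (us, B) ->
  (forall t, t \in us -> is_term t) /\
  flatten (rev stack) ++ w
  = flatten [seq t ++ [:: star] | t <- us] ++ [:: star] ++ B.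
Proof.
elim: w stack us => [|[] w IH] stack us stkP //.
  move=> /IH[|usP wE]; last first.
    by split=> //; rewrite -wE rev_cons flatten_rcons -catA.
  by move=> t; rewrite inE => /orP[/eqP->|/stkP//]; exact: is_term_var.
case: stack stkP => [|t [|s stack]] stkP /=.
- by move=> [<- <-].
- case E: arguments => [[us' B']|] //= [<- BB]; rewrite BB in E.
  have [|usP /= wE] := IH [::] us' _ E; first by [].
  split=> [x|]; last by rewrite /= wE /= cats0 -!catA.
  by rewrite inE => /orP[/eqP->|/usP//]; apply: stkP; rewrite mem_head.
- move=> /IH[|usP wE]; last first.
    by split=> //; rewrite -wE !rev_cons !flatten_rcons -!catA.
  move=> x; rewrite inE => /orP[/eqP->|xs].
    by apply: is_term_op; apply: stkP; rewrite !inE eqxx ?orbT.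
  by apply: stkP; rewrite !inE xs !orbT.
Qed.

(** The part A u_0 u_1 is [take d u], so A itself is never computed; the two top entries of the
    stack are u_1 and u_0. The pattern [w :: us] encodes n >= 2. *)
Definition expansion (d : nat) (u : word) : option word :=
  match foldl push [::] (take d u), arguments [::] (drop d u) with
  | _ :: u0 :: _, Some (w :: us, B) =>
      Some (take d u ++ [:: star]
        ++ flatten [seq u0 ++ u0 ++ x ++ [:: star; star; star] | x <- w :: us]
        ++ B)
  | _, _ => None
  end.

Lemma expands_expansion {d : nat} {u v u' : word} :
  expands d u v u' -> expansion d u = Some u'.
Proof.
move=> [A [B [C [u0 [u1 [us [[tu0 tu1 tus us_gt0] [dE -> _ ->]]]]]]]].
set X := flatten _ ++ _.
have -> : A ++ u0 ++ u1 ++ X = (A ++ u0 ++ u1) ++ X by rewrite -!catA.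
rewrite /expansion -dE take_size_cat // drop_size_cat // arguments_complete //.
rewrite !foldl_cat (foldl_push_term _ tu0) (foldl_push_term _ tu1).
by case: us us_gt0 {tus X} => // w us _; rewrite -!catA.
Qed.

Lemma expansion_expands {d : nat} {u v u' C : word} :
  v = take d u ++ [:: star] ++ C -> expansion d u = Some u' ->
  expands d u v u'.
Proof.
rewrite /expansion => vE.
have [A uE stkP] := foldl_push_sound (take d u).
case: (foldl _ _ _) uE stkP => [|u1 [|u0 stk]] // uE stkP.
case aE: arguments => [[[|w us] B]|] // [<-].
have [|usP /= dE] := arguments_sound _ aE; first by [].
have tuE : take d u = (A ++ flatten (rev stk)) ++ u0 ++ u1.
  by rewrite uE !rev_cons !flatten_rcons -!catA.
exists (A ++ flatten (rev stk)), B, C, u0, u1, (w :: us); do 2!split=> //.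
- by apply: stkP; rewrite !inE eqxx orbT.
- by apply: stkP; rewrite mem_head.
(* If d exceeded the length of u, [drop d u] would be empty, but by [dE] it contains a star. *)
- rewrite -tuE size_takel // leqNgt; apply/negP => /ltnW su.
  by move: dE; rewrite drop_oversize //; case: (w).
- by rewrite -{1}(cat_take_drop d u) dE tuE -!catA.
- by rewrite vE tuE -!catA.
- by rewrite tuE -!catA.
Qed.

Lemma expands_cat {d : nat} {u v u' : word} (P R S : word) :
  expands d u v u' ->
  expands (size P + d) (P ++ u ++ R) (P ++ v ++ S) (P ++ u' ++ R).
Proof.
move=> [A [B [C [u0 [u1 [us [tP [<- -> -> ->]]]]]]]].
exists (P ++ A), (B ++ R), (C ++ S), u0, u1, us; split=> //.
by split; rewrite -?size_cat -?catA.
Qed.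

(** * First differences, and a step as a partial function *)

Lemma first_diff_cons (a b : letter) (u v : word) :
  first_diff (a :: u) (b :: v)
  = if a == b then omap S (first_diff u v) else Some 0.
Proof.
rewrite /first_diff /= minnSS; case: eqP => //= _.
by rewrite ltnS; case: ifP.
Qed.

Lemma first_diffP (u v : word) (d : nat) :
  first_diff u v = Some d <->
  exists P a u' v',
    [/\ size P = d, u = P ++ a :: u' & v = P ++ ~~ a :: v'].
Proof.
split.
  elim: u v d => [|a u IH] [|b v] d //; rewrite first_diff_cons.
  case: eqP => [->|ab].
    case E: first_diff => [e|] //= [<-].
    have [P [c [u' [v' [sP -> ->]]]]] := IH _ _ E.
    by exists (b :: P), c, u', v'; rewrite /= sP.
  move=> [<-]; exists [::], a, u, v; split=> //.
  by case: a b ab => [] [].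
move=> [P [a [u' [v' [<- -> ->]]]]]; elim: P => [|b P IH] /=.
  by rewrite first_diff_cons; case: a.
by rewrite first_diff_cons eqxx IH.
Qed.

(** [None] arises both at a stopped pair and where the parser finds no dynamic range. Divergence is
    proved below by showing that all iterates are defined, which rules out both. *)
Definition next (p : word * word) : option (word * word) :=
  let: (u, v) := p in
  if first_diff u v is Some d then
    if nth var v d == star then omap (fun u' => (u', v)) (expansion d u)
    else omap (fun v' => (u, v')) (expansion d v)
  else None.

Lemma polish_stepP (u v u' v' : word) :
  polish_step u v u' v' <-> next (u, v) = Some (u', v').
Proof.
split.
  case=> d w dE nE wE; rewrite /next dE.
    by rewrite nE (expands_expansion wE).
  (* In a right step u has a star at d, so v has the opposite letter there and [next] takes its
     second branch. *)
  have /first_diffP[P [a [x [y [sP uE vE]]]]] := dE.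
  move: nE; rewrite {1}uE {1}vE -sP !nth_cat ltnn subnn /= => ->.
  by rewrite sP (expands_expansion wE).
rewrite /next; case dE: first_diff => [d|] //.
have /first_diffP[P [a [x [y [sP uE vE]]]]] := dE.
have nu : nth var u d = a by rewrite uE -sP nth_cat ltnn subnn.
have nv : nth var v d = ~~ a by rewrite vE -sP nth_cat ltnn subnn.
have tu : take d u = P by rewrite uE take_size_cat.
have tv : take d v = P by rewrite vE take_size_cat.
case: eqP => [nvE|nvE]; case eE: expansion => [w|] //= [<- <-].
  apply: (polish_step_left dE) => //.
  by apply: (expansion_expands _ eE); rewrite tu {1}vE -nv nvE.
have nuE : nth var u d = star by rewrite nu; case: (a) nv nvE => // ->.
apply: (polish_step_right dE) => //.
by apply: (expansion_expands _ eE); rewrite tv {1}uE -nu nuE.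
Qed.

(** * Contexts, iteration and self-reproducing pairs *)

Definition in_context (P R S : word) (p : word * word) : word * word :=
  (P ++ p.1 ++ R, P ++ p.2 ++ S).

Lemma next_in_context {p q : word * word} (P R S : word) :
  next p = Some q -> next (in_context P R S p) = Some (in_context P R S q).
Proof.
case: p q => u v [u' v'] /polish_stepP step_uv; apply/polish_stepP.
have dctx d : first_diff u v = Some d ->
    first_diff (P ++ u ++ R) (P ++ v ++ S) = Some (size P + d).
  move=> /first_diffP[Q [a [x [y [<- -> ->]]]]]; apply/first_diffP.
  by exists (P ++ Q), a, (x ++ R), (y ++ S); rewrite size_cat -!catA.
have nctx d w T : nth var w d = star ->
    nth var (P ++ w ++ T) (size P + d) = star.
  move=> wd; rewrite nth_cat ltnNge leq_addr addKn nth_cat ifT //.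
  by rewrite ltnNge; apply/negP => dw; rewrite nth_default in wd.
case: step_uv => d w dE nE wE.
  exact: polish_step_left (dctx _ dE) (nctx _ _ _ nE) (expands_cat _ _ _ wE).
exact: polish_step_right (dctx _ dE) (nctx _ _ _ nE) (expands_cat _ _ _ wE).
Qed.

Definition iter_next (n : nat) (p : word * word) : option (word * word) :=
  iter n (obind next) (Some p).

Lemma iter_next_in_context {n : nat} {p q : word * word} (P R S : word) :
  iter_next n p = Some q ->
  iter_next n (in_context P R S p) = Some (in_context P R S q).
Proof.
elim: n q => [|n IH] q; first by move=> [->].
rewrite /iter_next !iterS -/(iter_next n p).
rewrite -/(iter_next n (in_context P R S p)).
case E: (iter_next n p) => [r|] //= rq.
by rewrite (IH r) //=; exact: next_in_context.
Qed.

Lemma iter_next_add (m : nat) {n : nat} {p q : word * word} :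
  iter_next n p = Some q -> iter_next (m + n) p = iter_next m q.
Proof. by rewrite /iter_next iterD => ->. Qed.

(** [None] is absorbing under [obind next], so a defined iterate has only defined predecessors. *)
Lemma iter_next_leq {m n : nat} {p : word * word} :
  m <= n -> iter_next n p -> iter_next m p.
Proof.
move=> /subnK <-; case E: (iter_next m p) => [//|].
rewrite /iter_next iterD -/(iter_next m p) E.
by elim: (n - m) => //= k; case: (iter _ _ _) => // q /(_ isT).
Qed.

Lemma converges_iter_next {u v : word} :
  converges u v -> exists n, ~~ iter_next n (u, v).
Proof.
elim=> {u v} [u v dE|u v u' v' /polish_stepP step_uv _ [n nP]].
  by exists 1; rewrite /= dE.
by exists (n + 1); rewrite (iter_next_add n (q := (u', v'))).
Qed.

Lemma self_reproducing_diverges {n k : nat} {p q : word * word}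
    (P Q R S R' S' : word) :
  iter_next n.+1 p = Some (in_context Q R S p) ->
  iter_next k q = Some (in_context P R' S' p) -> diverges q.1 q.2.
Proof.
move=> pE qE /converges_iter_next[m].
rewrite -surjective_pairing => /negP; apply.
apply: (iter_next_leq (leq_addr k m)); rewrite (iter_next_add m qE).
(* Strong induction on the number m of further steps, for all contexts at once: a full period lowers
   m by n.+1 > 0 and only enlarges the context by Q, R and S. *)
elim/ltn_ind: m P R' S' {q qE} => m IH P R' S'.
have pE' := iter_next_in_context P R' S' pE.
have [mn|nm] := leqP m n.+1; first by apply: iter_next_leq mn _; rewrite pE'.
rewrite -(subnK (ltnW nm)) (iter_next_add _ pE').
have := IH (m - n.+1) _ (P ++ Q) (R ++ R') (S ++ S').
rewrite /in_context /= -!catA; apply.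
by rewrite ltn_subrL (leq_ltn_trans _ nm).
Qed.

(** * Depth at most 5: a finite check *)

Fixpoint stops_within (n : nat) (p : word * word) : bool :=
  (first_diff p.1 p.2 == None) ||
  (if n is n'.+1 then if next p is Some q then stops_within n' q else false
   else false).

Lemma stops_within_converges {n : nat} {u v : word} :
  stops_within n (u, v) -> converges u v.
Proof.
elim: n u v => [|n IH] u v /orP[/eqP dE|] //; try exact: converges_stop.
case E: next => [[u' v']|] // /IH; apply: converges_step.
exact/polish_stepP.
Qed.

Fixpoint terms_upto (n : nat) : seq word :=
  if n is n'.+1 then
    [:: var] :: [seq w <- [seq s ++ t ++ [:: star] | s <- terms_upto n',
                                                     t <- terms_upto n']
                 | depth w <= n]
  else [::].

Lemma depth_cat (s t : word) : depth (s ++ t) = depth s + depth t.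
Proof. exact: count_cat. Qed.

Lemma depth_term_gt0 {t : word} : is_term t -> 0 < depth t.
Proof. by elim=> // s u _ su _ _; rewrite depth_cat ltn_addr. Qed.

(** Both factors of a product have positive depth, so each is strictly less deep than the product
    and is found one round earlier. *)
Lemma mem_terms_upto {t : word} (n : nat) :
  is_term t -> depth t <= n -> t \in terms_upto n.
Proof.
move=> tt; elim: tt n => {t} [|s t ts IHs tt IHt] [|n] //.
  by rewrite leqn0 depth_cat addn_eq0 eqn0Ngt (depth_term_gt0 ts).
move=> stn; rewrite inE mem_filter stn /=; apply/orP; right.
move: stn; rewrite !depth_cat /= !addn0 => stn.
apply: allpairs_f; [apply: IHs|apply: IHt]; rewrite -ltnS;
  apply: leq_trans stn.
  by rewrite -addn1 leq_add2l depth_term_gt0.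
by rewrite -add1n leq_add2r depth_term_gt0.
Qed.

(** There are 1 + 1 + 2 + 5 + 14 = 23 terms to consider, hence 529 pairs, and 4 steps are enough for
    each of them. *)
Lemma all_terms_upto5_stop :
  all (fun u => all (fun v => stops_within 4 (u, v)) (terms_upto 5))
    (terms_upto 5).
Proof. by vm_compute. Qed.

Theorem theorem5p5 :
  (forall u v : word, is_term u -> is_term v ->
     depth u <= 5 -> depth v <= 5 -> converges u v) /\
  (exists u v : word,
     [/\ is_term u, is_term v, depth u <= 6, depth v <= 6 & diverges u v]) /\
  (let u := [:: 1; 1; 1; 0; 1; 0; 0]%letter in
   let v := [:: 1; 1; 0; 1; 0; 1; 1; 1; 0; 0; 0]%letter in
   [/\ is_term u, is_term v, depth u <= 6, depth v <= 6 & diverges u v]).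
Proof.
split.
  move=> u v tu tv du dv.
  have /allP/(_ u (mem_terms_upto 5 tu du)) := all_terms_upto5_stop.
  by move=> /allP/(_ v (mem_terms_upto 5 tv dv)); exact: stops_within_converges.
set w := (X in _ /\ X); suff wP : w by split=> //; do 2!eexists; exact: wP.
rewrite {}/w; set u := [:: _; _; _; _; _; _; _]; set v := [:: _, _, _ & _].
have tx := is_term_var; have txx := is_term_op tx tx.
split=> //.
- exact: (is_term_op tx (is_term_op txx tx)).
- exact: (is_term_op (is_term_op txx tx) (is_term_op tx txx)).
set a := [:: 1; 1; 0; 1; 1; 0; 1; 0; 0]%letter.
set b := [:: 1; 1; 0; 1; 0; 1; 1; 0; 1; 0; 1; 1; 0; 1;
             1; 0; 1; 1; 0; 1; 1; 0; 1; 0; 0; 0; 0; 0]%letter.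
(* The defaults never occur: the equations checked at the end force both iterates to be defined. *)
set p19 := odflt (u, v) (iter_next 19 (u, v)).
set p5 := odflt (a, b) (iter_next 5 (a, b)).
(* The index 4 stands for period 5. The words a and b start at position 57 in the two words of [p19]
   and at position 20 in those of [p5]; the contexts are cut out around them. *)
apply: (@self_reproducing_diverges 4 19 (a, b) (u, v)
  (take 57 p19.1) (take 20 p5.1)
  (drop (20 + size a) p5.1) (drop (20 + size b) p5.2)
  (drop (57 + size a) p19.1) (drop (57 + size b) p19.2)); by vm_compute.
Qed.
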